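(* Consider the leader-follower networked system $$x_0(k+1)=A_{00}x_0(k)+B_{00}u_0(k)+w_0(k),$$ $$x_1(k+1)=A_{11}x_1(k)+B_{11}u_1(k)+w_1(k)+A_{10}x_0(k)+B_{10}u_0(k),$$ with the information $\sigma$-algebras $\mathcal{F}_0(k),\mathcal{F}_1(k)$ and the admissibility and weighting assumptions described in the context. Let $\hat{x}_1(k|k)=\mathbb{E}[x_1(k)|\mathcal{F}_0(k)]$ and $\hat{u}_1(k)=\mathbb{E}[u_1(k)|\mathcal{F}_0(k)]$. Then the optimal estimate (conditional expectation) $\hat{x}_1(k|k)$ satisfies the recursion, for $k=1,\dots,N$, $$\hat{x}_1(k|k)=A_{11}\hat{x}_1(k-1|k-1)+B_{11}\hat{u}_1(k-1)+A_{10}x_0(k-1)+B_{10}u_0(k-1),$$ with the initial condition $\hat{x}_1(0|0)=\bar{x}_1$.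
   Context: States $x_0(k),x_1(k)\in\mathbb{R}^n$ (leader, follower), controls $u_0(k)\in\mathbb{R}^{m_1}$, $u_1(k)\in\mathbb{R}^{m_2}$; $A_{00},A_{10},A_{11},B_{00},B_{10},B_{11}$ are constant matrices of compatible dimensions. $w_0(k),w_1(k)$ are Gaussian white noises, $w_i(k)\sim\mathcal{N}(0,\Sigma_{w_i})$; the initial states satisfy $x_i(0)\sim\mathcal{N}(\bar{x}_i,\Sigma_{x_i})$, $i=0,1$. The family $\{x_0(0),x_1(0),w_0(0),\dots,w_0(k),w_1(0),\dots,w_1(k)\}$ is mutually independent for each $k$. Information: $\mathcal{F}_0(k)$ is the $\sigma$-algebra generated by $\{x_0(0),\dots,x_0(k),u_0(0),\dots,u_0(k-1)\}$, and $\mathcal{F}_1(k)$ is the $\sigma$-algebra generated by $\{x_0(0),\dots,x_0(k),u_0(0),\dots,u_0(k-1),x_1(0),\dots,x_1(k),u_1(0),\dots,u_1(k-1)\}$. Assumption 1: $u_i(k)$ is $\mathcal{F}_i(k)$-measurable for $i=0,1$, and $\sum_{k=0}^{N}\mathbb{E}[u_i(k)^\top u_i(k)]<\infty$. Assumption 2: in the cost $J_N=\mathbb{E}\big[\sum_{k=0}^{N}(X^\top(k)QX(k)+U^\top(k)RU(k))\big]+\mathbb{E}[X(N+1)^\top P(N+1)X(N+1)]$, with $X(k)=[x_0^\top(k)\ x_1^\top(k)]^\top$ and $U(k)=[u_0^\top(k)\ u_1^\top(k)]^\top$, the symmetric weighting matrices satisfy $Q\ge 0$, $R>0$, $P(N+1)\ge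 0$. *)

(* Defs.v *)
From HB Require Import structures.
From mathcomp Require Import all_boot all_order all_algebra.
From mathcomp Require Import all_classical all_reals all_analysis.

Set Implicit Arguments.
Unset Strict Implicit.
Unset Printing Implicit Defensive.
Import Order.TTheory GRing.Theory Num.Theory.
Local Open Scope classical_set_scope.
Local Open Scope ring_scope.

Definition psdmx (R : realType) (n : nat) (S : 'M[R]_n) : Prop :=
  S^T = S /\ forall v : 'cV[R]_n, 0 <= (v^T *m S *m v) 0 0.

Definition pdmx (R : realType) (n : nat) (S : 'M[R]_n) : Prop :=
  S^T = S /\ forall v : 'cV[R]_n, v != 0 -> 0 < (v^T *m S *m v) 0 0.

(* The events {t | X t i \in B}, i a coordinate and B a Borel set of R: they
   generate the sigma-algebra of the random vector X, the Borel sigma-algebra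
   of R^n being generated by the coordinate projections. *)
Definition coord_events (T : Type) (R : realType) (n : nat)
    (X : T -> 'cV[R]_n) : set_system T :=
  [set A | exists i : 'I_n, exists2 B : set R,
    measurable B & A = (fun t => X t i 0) @^-1` B].

Definition sigma_vec (T : Type) (R : realType) (n : nat)
    (X : T -> 'cV[R]_n) : set_system T :=
  <<s coord_events X >>.

Definition vec_measurable (T : Type) (R : realType) (n : nat)
    (G : set_system T) (X : T -> 'cV[R]_n) : Prop :=
  sigma_vec X `<=` G.

Definition leader_info (T : Type) (R : realType) (n m1 : nat)
    (x0 : nat -> T -> 'cV[R]_n) (u0 : nat -> T -> 'cV[R]_m1) (k : nat) :
    set_system T :=
  <<s [set A | (exists2 j, (j <= k)%N & coord_events (x0 j) A) \/
               (exists2 j, (j < k)%N & coord_events (u0 j) A)] >>.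

Definition follower_info (T : Type) (R : realType) (n m1 m2 : nat)
    (x0 : nat -> T -> 'cV[R]_n) (u0 : nat -> T -> 'cV[R]_m1)
    (x1 : nat -> T -> 'cV[R]_n) (u1 : nat -> T -> 'cV[R]_m2) (k : nat) :
    set_system T :=
  <<s [set A | [\/ exists2 j, (j <= k)%N & coord_events (x0 j) A,
                   exists2 j, (j < k)%N & coord_events (u0 j) A,
                   exists2 j, (j <= k)%N & coord_events (x1 j) A |
                   exists2 j, (j < k)%N & coord_events (u1 j) A]] >>.

Section Probability.
Context (d : measure_display) (T : measurableType d) (R : realType).
Variable P : probability T R.

Definition mutually_independent (I : finType) (n : nat)
    (X : I -> T -> 'cV[R]_n) : Prop :=
  forall (J : {set I}) (A : I -> set T),
    (forall i, i \in J -> sigma_vec (X i) (A i)) ->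
    P (\bigcap_(i in [set` J]) A i) = (\prod_(i in J) P (A i))%E.

(* Law N(m, v) on R, parametrized by its variance v >= 0.  The library's
   [normal_prob] takes the standard deviation, and is not the point mass when
   that is 0, so the degenerate case is set apart. *)
Definition normal_law (m v : R) (B : set R) : \bar R :=
  if v == 0 then \d_m B else normal_prob m (Num.sqrt v) B.

(* X ~ N(mu, S), S possibly singular: every linear form a^T X has the law
   N(a^T mu, a^T S a) on R. *)
Definition gaussian (n : nat) (X : T -> 'cV[R]_n) (mu : 'cV[R]_n)
    (S : 'M[R]_n) : Prop :=
  [/\ psdmx S, vec_measurable measurable X &
    forall (a : 'cV[R]_n) (B : set R), measurable B ->
      P ((fun t => (a^T *m X t) 0 0) @^-1` B) =
      normal_law ((a^T *m mu) 0 0) ((a^T *m S *m a) 0 0) B].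

(* Y is a version of the conditional expectation E[X | G], taken coordinate
   by coordinate, for an integrable random vector X and a sub-sigma-algebra
   G; versions differ only on P-null sets. *)
Definition is_cond_exp (n : nat) (G : set_system T) (X Y : T -> 'cV[R]_n) :
    Prop :=
  vec_measurable G Y /\
  forall i : 'I_n,
    P.-integrable setT (fun t => (Y t i 0)%:E) /\
    forall A, G A ->
      (\int[P]_(t in A) (Y t i 0)%:E = \int[P]_(t in A) (X t i 0)%:E)%E.

End Probability.

(* The family x0(0), x1(0), w0(0), ..., w0(k), w1(0), ..., w1(k). *)
Definition primitive_vectors (T : Type) (R : realType) (n : nat)
    (x0 x1 w0 w1 : nat -> T -> 'cV[R]_n) (k : nat)
    (i : bool + bool * 'I_k.+1) : T -> 'cV[R]_n :=
  match i with
  | inl false => x0 0%N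
  | inl true => x1 0%N
  | inr (false, j) => w0 j
  | inr (true, j) => w1 j
  end.
Arguments primitive_vectors {T R n} x0 x1 w0 w1 k i.

(* Main.v *)
(* By induction, the follower's information F1(k) lies in the sigma-algebra
   generated by x0(0), x1(0) and the noises before time k, which is independent
   of w0(k), while F0(k+1) lies in the join of F0(k) and the sigma-algebra of
   w0(k).  By a pi-lambda argument the increment w0(k) brings no information:
   E[x1(k) | F0(k+1)] = E[x1(k) | F0(k)], and likewise for u1(k).  As w1(k) is
   centered and independent of F0(k+1), conditioning the dynamics of x1 on
   F0(k+1) gives the recursion.  The centering of a Gaussian vector comes from
   the symmetry of its law. *)

Require Import Defs.
From HB Require Import structures.
From mathcomp Require Import all_boot all_order all_algebra.
From mathcomp Require Import all_classical all_reals all_analysis.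
From mathcomp Require Import measurable_realfun.
From mathcomp Require Import ring lra.

Set Implicit Arguments.
Unset Strict Implicit.
Unset Printing Implicit Defensive.
Import Order.TTheory GRing.Theory Num.Theory.
Local Open Scope classical_set_scope.
Local Open Scope ring_scope.

(** * Moments of the normal law *)

(** Conditional expectations occur only as given versions, fixed up to null sets. The recursion is
    therefore proved by writing the difference of its two sides as a linear combination of variables
    whose integrals over all events of F0(k+1) vanish; this difference is also F0(k+1)-measurable,
    and such a variable is almost surely 0. The obstacle is that the error [x1 k - xhat1 k] is not
    known to the leader. Independence of w0(k) from F0(k) alone would not let its integral split
    over the intersection of an event A of F0(k) with an event C of w0(k): the error times the
    indicator of A must itself be independent of C. This is why a sigma-algebra large enough to
    carry the error, yet independent of w0(k), has to contain F0(k). Symmetry determines the mean of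
    a normal variable only once its first moment is known to be finite, hence the preliminary bounds
    on the normal density. *)

Lemma lebesgue_measure_reflect (R : realType) (c : R) (B : set R) :
  measurable B ->
  lebesgue_measure ((fun x => c - x) @^-1` B) = lebesgue_measure B.
Proof.
move=> mB.
pose phi (x : measurableTypeR R) : measurableTypeR R := c - x.
have mphi : measurable_fun [set: measurableTypeR R] phi.
  exact: measurable_funB.
apply/esym.
apply: (lebesgue_measure_unique (mu := pushforward lebesgue_measure phi)) => //.
move=> _ [[a b] _ <-] /=.
rewrite /pushforward.
(* Reflection exchanges the open and the closed end, so the preimage leaves the generating class of
   intervals, but its length is unchanged. *)
have -> : phi @^-1` `]a, b] = `[c - b, c - a[%classic.
  have E (x : R) : (a < c - x <= b) = (c - b <= x < c - a).
    by rewrite andbC lerBlDr -lerBlDl ltrBrDr -ltrBrDl.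
  by apply/seteqP; split => x /=; rewrite !in_itv/= E.
rewrite !lebesgue_measure_itv/= !lte_fin ltrD2l ltrN2.
by case: ifPn => // _; rewrite -!EFinD; congr EFin; lra.
Qed.

(** Change of variables holds with the Radon-Nikodym derivative, which agrees with [normal_pdf]
    almost everywhere because both have the same integral over every measurable set. *)
Lemma ge0_integral_normal_prob (R : realType) (m s : R) (f : R -> \bar R) :
  measurable_fun setT f -> (forall x, 0 <= f x)%E ->
  (\int[normal_prob m s]_x f x =
   \int[lebesgue_measure]_x (f x * (normal_pdf m s x)%:E))%E.
Proof.
move=> mf f0.
have dom := normal_prob_dominates m s.
have intRN := Radon_Nikodym_SigmaFinite.f_integrable dom.
have mpdf : measurable_fun setT (EFin \o normal_pdf m s).
  by apply/measurable_EFinP; exact: measurable_normal_pdf.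
rewrite -(Radon_Nikodym_SigmaFinite.change_of_variables dom)//.
apply: ae_eq_integral => //.
- by apply: emeasurable_funM => //; exact: measurable_int intRN.
- exact: emeasurable_funM.
- apply: ae_eqe_mul2l.
  apply: integral_ae_eq => // E _ mE.
  by rewrite -Radon_Nikodym_SigmaFinite.f_integral.
Qed.

Lemma normal_pdf_reflect (R : realType) (m s x : R) : s != 0 ->
  normal_pdf m s (m *+ 2 - x) = normal_pdf m s x.
Proof.
move=> s0; rewrite !normal_pdfE// /normal_fun -[in RHS]sqrrN opprB.
by rewrite mulr2n addrAC addrK.
Qed.

Lemma normal_prob_reflect (R : realType) (m s : R) (B : set R) :
  s != 0 -> measurable B ->
  normal_prob m s ((fun x => m *+ 2 - x) @^-1` B) = normal_prob m s B.
Proof.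
move=> s0 mB.
pose phi (x : measurableTypeR R) : measurableTypeR R := m *+ 2 - x.
have mphi : measurable_fun [set: measurableTypeR R] phi.
  exact: measurable_funB.
(* On the right, Lebesgue measure is replaced by its image under [phi], which equals it; the change
   of variables then leaves the symmetry of the density. *)
rewrite /normal_prob [RHS](eq_measure_integral
  (pushforward lebesgue_measure phi)); last first.
  by move=> A mA _; rewrite /= /pushforward lebesgue_measure_reflect.
rewrite (ge0_integral_pushforward mphi)//.
- by apply: eq_integral => x _; rewrite /= normal_pdf_reflect.
- by apply/measurable_funTS/measurable_EFinP; exact: measurable_normal_pdf.
- by move=> y _; rewrite lee_fin normal_pdf_ge0.
Qed.


Lemma normal_pdf_moment_le (R : realType) (m s : R) : s != 0 ->
  exists C : R, forall x,
    `|x - m| * normal_pdf m s x <= C * normal_pdf m (s *+ 2) x.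
Proof.
(* For z = x - m and b = 3 / (8 s^2), the ratio of the two exponentials is
   exp(- b z^2), and |z| <= 1 + z^2 <= (1 + 1/b) exp(b z^2). *)
move=> s0; have s20 : s *+ 2 != 0 by rewrite mulrn_eq0.
have b0 : 0 < 3 / (8 * s ^+ 2) :> R.
  by rewrite divr_gt0// mulr_gt0// exprn_even_gt0.
move: b0; set b : R := 3 / _ => b0.
exists ((1 + b^-1) * normal_peak s / normal_peak (s *+ 2)) => x.
rewrite !normal_pdfE// [leRHS]mulrA divfK ?gt_eqF ?normal_peak_gt0//.
rewrite mulrCA -!mulrA [leRHS]mulrCA ler_wpM2l ?normal_peak_ge0//.
rewrite /normal_fun; set z := x - m.
have -> : - z ^+ 2 / (s ^+ 2 *+ 2) =
    - z ^+ 2 / ((s *+ 2) ^+ 2 *+ 2) - b * z ^+ 2.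
  by rewrite /b; field.
rewrite expRD mulrCA [leRHS]mulrC ler_wpM2l ?expR_ge0//.
rewrite expRN ler_pdivrMr ?expR_gt0//.
have zle : `|z| <= 1 + z ^+ 2.
  by rewrite -real_normK ?num_real//; nra.
rewrite (le_trans zle)//.
have bz : 1 + b * z ^+ 2 <= expR (b * z ^+ 2) by exact: expR_ge1Dx.
have b1 : 0 <= 1 + b^-1 by rewrite addr_ge0// invr_ge0 ltW.
rewrite (le_trans _ (ler_wpM2l b1 bz))//.
have -> : (1 + b^-1) * (1 + b * z ^+ 2) = 1 + b * z ^+ 2 + b^-1 + z ^+ 2.
  by field; rewrite gt_eqF.
have bi : 0 < b^-1 by rewrite invr_gt0.
have := sqr_ge0 z; nra.
Qed.

(** The factor [|x - m|] is absorbed by doubling the deviation, so the first moment is dominated by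
    a multiple of another normal density, whose integral is finite. *)
Lemma integrable_normal_prob (R : realType) (m s : R) : s != 0 ->
  (normal_prob m s).-integrable setT (fun x => (x - m)%:E).
Proof.
move=> s0; apply/integrableP; split.
  by apply/measurable_EFinP; exact: measurable_funB.
have [C HC] := normal_pdf_moment_le m s0.
rewrite ge0_integral_normal_prob//; last first.
  by do 2 apply: measurableT_comp => //; exact: measurable_funB.
have intC : lebesgue_measure.-integrable [set: R]
    (fun x => C%:E * (normal_pdf m (s *+ 2) x)%:E)%E.
  by apply: integrableZl => //; exact: integrable_normal_pdf.
have /integrableP[_] := intC.
apply: le_lt_trans; apply: ge0_le_integral => //=.
- by move=> x _; rewrite lee_fin mulr_ge0// normal_pdf_ge0.
- apply: emeasurable_funM.
    by do 2 apply: measurableT_comp => //; exact: measurable_funB.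
  by apply/measurable_EFinP; exact: measurable_normal_pdf.
- do 2 apply: measurableT_comp => //.
  by apply: measurable_funM => //; exact: measurable_normal_pdf.
- by move=> x _; rewrite lee_fin (le_trans (HC x))// ler_norm.
Qed.

(** Spaces and measures are arbitrary so that one transfer serves two purposes: computing a moment
    on the real line, with [Y := id] under a normal or Dirac law, and comparing a restricted with a
    rescaled probability on a single space. *)
Lemma ge0_integral_law d1 d2 (T1 : measurableType d1) (T2 : measurableType d2)
    (R : realType) (m1 : {measure set T1 -> \bar R})
    (m2 : {measure set T2 -> \bar R}) (X : T1 -> R) (Y : T2 -> R)
    (f : R -> \bar R) :
  measurable_fun setT X -> measurable_fun setT Y ->
  (forall B, measurable B -> m1 (X @^-1` B) = m2 (Y @^-1` B)) ->
  measurable_fun setT f -> (forall y, 0 <= f y)%E ->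
  (\int[m1]_t f (X t) = \int[m2]_t f (Y t))%E.
Proof.
move=> mX mY XY mf f0.
rewrite -[LHS](ge0_integral_pushforward mX m1 measurableT mf)//.
rewrite -[RHS](ge0_integral_pushforward mY m2 measurableT mf)//.
by apply: eq_measure_integral => A mA _; exact: XY.
Qed.

Lemma integral_law d1 d2 (T1 : measurableType d1) (T2 : measurableType d2)
    (R : realType) (m1 : {measure set T1 -> \bar R})
    (m2 : {measure set T2 -> \bar R}) (X : T1 -> R) (Y : T2 -> R) :
  measurable_fun setT X -> measurable_fun setT Y ->
  (forall B, measurable B -> m1 (X @^-1` B) = m2 (Y @^-1` B)) ->
  (\int[m1]_t (X t)%:E = \int[m2]_t (Y t)%:E)%E.
Proof.
move=> mX mY XY.
rewrite (integralE _ _ (EFin \o X)) (integralE _ _ (EFin \o Y)).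
rewrite (funepos_comp EFin X) (funepos_comp EFin Y).
rewrite (funeneg_comp EFin X) (funeneg_comp EFin Y); congr (_ - _)%E.
- apply: (ge0_integral_law mX mY XY (f := EFin^\+%E)) => //.
  by apply: measurable_funepos; exact: EFin_measurable.
- apply: (ge0_integral_law mX mY XY (f := EFin^\-%E)) => //.
  by apply: measurable_funeneg; exact: EFin_measurable.
Qed.

Lemma normal_law_reflect (R : realType) (m v : R) (B : set R) :
  0 <= v -> measurable B ->
  normal_law m v ((fun x => m *+ 2 - x) @^-1` B) = normal_law m v B.
Proof.
move=> v0 mB; rewrite /normal_law; case: eqVneq => [_|vn0].
  by rewrite !diracE; congr ((_ : bool)%:R%:E); apply/idP/idP; rewrite !inE/=;
    rewrite mulr2n addrK.
by rewrite normal_prob_reflect// gt_eqF// sqrtr_gt0 lt_neqAle eq_sym vn0.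
Qed.

(** [X] and [m *+ 2 - X] have the same law, so the expectation e satisfies e = 2m - e; solving this
    for e requires e to be finite, which is settled first. *)
Lemma normal_law_moment (d : measure_display) (T : measurableType d)
    (R : realType) (P : probability T R) (X : T -> R) (m v : R) :
  0 <= v -> measurable_fun setT X ->
  (forall B, measurable B -> P (X @^-1` B) = normal_law m v B) ->
  P.-integrable setT (fun t => (X t)%:E) /\ (\int[P]_t (X t)%:E = m%:E)%E.
Proof.
move=> v0 mX lawX.
have mabs : measurable_fun [set: R] (fun x : R => `|x - m|%:E).
  by do 2 apply: measurableT_comp => //; exact: measurable_funB.
(* The deviation from [m] is transferred to the real line: its absolute value integrates to 0 under
   the point mass, and the moment bound controls it otherwise. *)
have intXm : P.-integrable setT (fun t => (X t - m)%:E).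
  apply/integrableP; split.
    by apply/measurable_EFinP; exact: measurable_funB.
  move: lawX; rewrite /normal_law; case: eqVneq => [_|vn0] lawX.
    rewrite (ge0_integral_law (m2 := \d_m) (Y := id)
      (f := fun x => `|x - m|%:E))//.
    by rewrite integral_dirac//= ?diracE ?mem_set//= mul1e ltry.
  have s0 : Num.sqrt v != 0.
    by rewrite gt_eqF// sqrtr_gt0 lt_neqAle eq_sym vn0.
  rewrite (ge0_integral_law (m2 := normal_prob m (Num.sqrt v)) (Y := id)
    (f := fun x => `|x - m|%:E))//.
  by have /integrableP[] := integrable_normal_prob m s0.
have intX : P.-integrable setT (fun t => (X t)%:E).
  apply: (eq_integrable _ (fun t => (X t - m)%:E + (cst m t)%:E)%E) => //.
    by move=> t _; rewrite -EFinD subrK.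
  apply: integrableD => //.
  exact: finite_measure_integrable_cst.
split=> //.
have mX' : measurable_fun setT (fun t => m *+ 2 - X t).
  exact: measurable_funB.
have lawE : (\int[P]_t (X t)%:E = \int[P]_t (m *+ 2 - X t)%:E)%E.
  apply: integral_law => // B mB.
  transitivity (P (X @^-1` ((fun x => m *+ 2 - x) @^-1` B))); last by [].
  have mB' : measurable ((fun x : R => m *+ 2 - x) @^-1` B).
    by rewrite -[X in measurable X]setTI; exact: measurable_funB.
  by rewrite [LHS]lawX// [RHS]lawX// normal_law_reflect.
have : (\int[P]_t (m *+ 2 - X t)%:E = (m *+ 2)%:E - \int[P]_t (X t)%:E)%E.
  under eq_integral do rewrite EFinB.
  rewrite integralB//=; last exact: finite_measure_integrable_cst.
  by rewrite integral_cst//= probability_setT mule1.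
rewrite -lawE.
have /fineK <- := integrable_fin_num measurableT intX.
rewrite -EFinB => -[] /eqP; rewrite eq_sym subr_eq -mulr2n => /eqP h.
by congr EFin; lra.
Qed.

(** A coordinate is the linear form of a basis vector, hence has a one-dimensional normal law; its
    variance is nonnegative because [S] is positive semidefinite. *)
Lemma gaussian_moment (d : measure_display) (T : measurableType d)
    (R : realType) (P : probability T R) (n : nat) (X : T -> 'cV[R]_n)
    (mu : 'cV[R]_n) (S : 'M[R]_n) (i : 'I_n) :
  gaussian P X mu S ->
  P.-integrable setT (fun t => (X t i 0)%:E) /\
  (\int[P]_t (X t i 0)%:E = (mu i 0)%:E)%E.
Proof.
case=> -[_ S0] mX lawX.
have coordE (v : 'cV[R]_n) : ((delta_mx i 0 : 'cV[R]_n)^T *m v) 0 0 = v i 0.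
  by rewrite trmx_delta -rowE mxE.
apply: (normal_law_moment (S0 (delta_mx i 0))).
  move=> _ B mB; rewrite setTI; apply: mX; apply: sub_sigma_algebra.
  by exists i, B.
move=> B mB; rewrite -coordE -lawX//.
by congr (P (_ @^-1` B)); apply/funext => t; rewrite coordE.
Qed.

(** * Independence *)

(** Turns an integral over an event into one over the whole space against another measure, a form to
    which equality of laws applies. *)
Lemma ge0_integral_mrestr (d : measure_display) (T : measurableType d)
    (R : realType) (m : {measure set T -> \bar R}) (C : set T)
    (mC : measurable C) (f : T -> \bar R) :
  measurable_fun setT f -> (forall t, 0 <= f t)%E ->
  (\int[mrestr m mC]_t f t = \int[m]_(t in C) f t)%E.
Proof.
move=> mf f0; rewrite [LHS](ge0_negligible_integral (measurableC mC))//;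
  last first.
  by rewrite /= /mrestr setICl measure0.
rewrite setTD setCK; apply: eq_measure_integral => A mA AC.
by rewrite /= /mrestr setIidl.
Qed.

(** Independence says that [Z] has the same image measure under [P] restricted to [C] and under [P]
    scaled by [P C]; integrals of the positive and negative parts then agree under both. *)
Lemma integral_indep_setI (d : measure_display) (T : measurableType d)
    (R : realType) (P : probability T R) (Z : T -> R) (C : set T) :
  P.-integrable setT (fun t => (Z t)%:E) -> measurable C ->
  (forall B, measurable B -> P (Z @^-1` B `&` C) = (P (Z @^-1` B) * P C)%E) ->
  (\int[P]_(t in C) (Z t)%:E = P C * \int[P]_t (Z t)%:E)%E.
Proof.
move=> intZ mC indepZ.
have mZE := measurable_int _ intZ.
have mZ : measurable_fun setT Z by exact/measurable_EFinP.
have k0 : 0 <= fine (P C) by rewrite fine_ge0.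
have kE : (fine (P C))%:E = P C by rewrite fineK// fin_num_measure.
have law B : measurable B ->
    mrestr P mC (Z @^-1` B) = mscale (NngNum k0) P (Z @^-1` B).
  by move=> mB; rewrite /mrestr /mscale/= kE indepZ// muleC.
have indep_ge0 f : measurable_fun [set: R] f -> (forall y, 0 <= f y)%E ->
    (\int[P]_(t in C) f (Z t) = P C * \int[P]_t f (Z t))%E.
  move=> mf f0; have mfZ : measurable_fun setT (fun t => f (Z t)).
    exact: measurableT_comp.
  rewrite -(ge0_integral_mrestr P mC mfZ)// -kE.
  rewrite -(ge0_integral_mscale P measurableT (NngNum k0))//.
  exact: (ge0_integral_law mZ mZ law).
rewrite (integralE _ C (EFin \o Z)) (integralE _ setT (EFin \o Z)).
rewrite (funepos_comp EFin Z) (funeneg_comp EFin Z).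
rewrite !indep_ge0//; last 2 first.
- by apply: measurable_funeneg; exact: EFin_measurable.
- by apply: measurable_funepos; exact: EFin_measurable.
(* Distributing [P C] over the difference needs the two parts not to be both infinite, which
   integrability guarantees. *)
rewrite [RHS]muleBr ?fin_num_measure//.
have := integrable_add_def measurableT (intZ : P.-integrable setT (EFin \o Z)).
by rewrite (funepos_comp EFin Z) (funeneg_comp EFin Z).
Qed.

Lemma sigma_vec_algebra (T : Type) (R : realType) (n : nat)
    (X : T -> 'cV[R]_n) : sigma_algebra setT (sigma_vec X).
Proof. exact: smallest_sigma_algebra. Qed.

Lemma sigma_algebraT (T : Type) (G : set_system T) :
  sigma_algebra setT G -> G setT.
Proof. by move=> [G0 GD _]; rewrite -(setD0 setT); exact: GD. Qed.

Lemma sigma_algebra_setC (T : Type) (G : set_system T) (A : set T) :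
  sigma_algebra setT G -> G A -> G (~` A).
Proof. by move=> [_ GD _] GA; rewrite -setTD; exact: GD. Qed.

Lemma sigma_algebra_setI (T : Type) (G : set_system T) (A B : set T) :
  sigma_algebra setT G -> G A -> G B -> G (A `&` B).
Proof.
move=> sG GA GB; rewrite -(setCK A) -(setCK B) -setCU -bigcup2E.
apply: sigma_algebra_setC => //; case: (sG) => G0 _; apply => -[|[|//]] /=;
  exact: sigma_algebra_setC.
Qed.

(* The pi-system used here consists of the intersections of one event from each
   X i, i \in J. *)
Lemma mutually_independent_group (d : measure_display) (T : measurableType d)
    (R : realType) (P : probability T R) (I : finType) (n : nat)
    (X : I -> T -> 'cV[R]_n) (J : {set I}) (i0 : I) (A C : set T) :
  (forall i, vec_measurable measurable (X i)) ->
  mutually_independent P X -> i0 \notin J ->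
  <<s [set E | exists2 i, i \in J & coord_events (X i) E] >> A ->
  sigma_vec (X i0) C ->
  P (A `&` C) = (P A * P C)%E.
Proof.
move=> mX indepX i0J sA sC.
have mC : measurable C by exact: mX sC.
have k0 : 0 <= fine (P C) by rewrite fine_ge0.
have kE : (fine (P C))%:E = P C by rewrite fineK// fin_num_measure.
pose G := [set E | exists2 F : I -> set T, (forall i, sigma_vec (X i) (F i)) &
  E = \bigcap_(i in [set` J]) F i].
have sXT i : sigma_vec (X i) setT.
  by apply: sigma_algebraT; exact: sigma_vec_algebra.
have GT : G setT.
  by exists (fun=> setT) => //; rewrite bigcapT.
(* Both sides of the product formula are finite measures in [A], so it is enough to compare them on
   the pi-system [G]. *)
suff : mrestr P mC A = mscale (NngNum k0) P A.
  by rewrite /mrestr /mscale/= kE muleC.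
apply: (g_sigma_algebra_measure_unique G _ (fun=> setT)) => //.
- move=> _ [F sF ->]; apply: fin_bigcap_measurable => // i _.
  exact: mX (sF i).
- by rewrite bigcup_const.
- move=> _ _ [F sF ->] [F' sF' ->]; exists (fun i => F i `&` F' i).
    by move=> i; exact: (sigma_algebra_setI (sigma_vec_algebra (X i))).
  by rewrite bigcapI.
- move=> _ [F sF ->].
  (* Taking [C] as the event of index [i0] makes the intersection with [C] a family indexed by
     [i0 |: J]; independence for this set and for [J] gives the factorization. *)
  pose F' i := if i == i0 then C else F i.
  have sF' i : sigma_vec (X i) (F' i).
    by rewrite /F'; case: eqVneq => [->|].
  have F'E i : i \in J -> F' i = F i.
    by rewrite /F'; case: eqVneq => [->|//]; rewrite (negbTE i0J).
  rewrite /= /mrestr /mscale/= kE.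
  have := indepX (i0 |: J) F' (fun i _ => sF' i).
  rewrite big_setU1//= {2}/F' eqxx => E.
  rewrite [X in (_ * X)%E](indepX J F)//.
  rewrite (eq_bigr (fun i => P (F' i))); last by move=> i iJ; rewrite F'E.
  rewrite -E; congr (P _); apply/seteqP; split => t.
    move=> [Ft Ct] i /=; rewrite !inE /F'; case: eqVneq => // _ /= iJ.
    exact: Ft.
  move=> Ft; split.
    by move=> i /= iJ; rewrite -F'E//; apply: Ft; rewrite /= !inE iJ orbT.
  by have := Ft i0; rewrite /F' eqxx; apply; rewrite /= !inE eqxx.
- move=> _; rewrite /= /mrestr setTI.
  by rewrite (le_lt_trans (probability_le1 _ _)) ?ltry.
- apply: (smallest_sub _ _ sA); first exact: smallest_sigma_algebra.
  move=> E [j jJ] XE; apply: sub_sigma_algebra.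
  exists (fun i => if i == j then E else setT).
    by move=> i; case: eqVneq => [->|//]; exact: sub_sigma_algebra.
  apply/seteqP; split => t.
    by move=> Et i _; case: ifP.
  by move=> /(_ j jJ); rewrite eqxx.
Qed.

(** * Functions with null conditional expectation *)

(** Sub-sigma-algebras stay set systems on the one type [T], so that several of them can be compared
    by inclusion. *)
Definition measurable_wrt (T : Type) (R : realType) (G : set_system T)
    (f : T -> R) : Prop :=
  forall B, measurable B -> G (f @^-1` B).

(** A sigma-algebra generates itself, so this is a bridge to ordinary measurable functions, from
    which closure under algebraic operations is imported. *)
Lemma measurable_wrtP (T : pointedType) (R : realType) (G : set_system T)
    (f : T -> R) : sigma_algebra setT G ->
  measurable_wrt G f <-> measurable_fun setT (f : g_sigma_algebraType G -> R).
Proof.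
move=> sG; rewrite /measurable_fun measurable_g_measurableTypeE//.
split=> [Gf _ B mB|Gf B mB]; first by rewrite setTI; exact: Gf.
by rewrite -[X in G X]setTI; apply: Gf => //; exact: sigma_algebraT.
Qed.

Section measurable_wrt_theory.
Context (T : pointedType) (R : realType) (G : set_system T).
Hypothesis sG : sigma_algebra setT G.
Implicit Types f g : T -> R.

Lemma measurable_wrtD f g :
  measurable_wrt G f -> measurable_wrt G g ->
  measurable_wrt G (fun t => f t + g t).
Proof.
by rewrite !measurable_wrtP// => mf mg; exact: measurable_funD.
Qed.

Lemma measurable_wrtB f g :
  measurable_wrt G f -> measurable_wrt G g ->
  measurable_wrt G (fun t => f t - g t).
Proof.
by rewrite !measurable_wrtP// => mf mg; exact: measurable_funB.
Qed.

Lemma measurable_wrtZ (a : R) f :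
  measurable_wrt G f -> measurable_wrt G (fun t => a * f t).
Proof.
by rewrite !measurable_wrtP// => mf; exact: measurable_funM.
Qed.

Lemma measurable_wrt_sum (I : Type) (s : seq I) (f : I -> T -> R) :
  (forall i, measurable_wrt G (f i)) ->
  measurable_wrt G (fun t => \sum_(i <- s) f i t).
Proof.
move=> mf; rewrite measurable_wrtP//; apply: measurable_sum => i.
by rewrite -measurable_wrtP.
Qed.

Lemma measurable_wrt_indic f (A : set T) :
  G A -> measurable_wrt G f -> measurable_wrt G (fun t => f t * \1_A t).
Proof.
move=> GA; rewrite !measurable_wrtP// => mf.
have mA : measurable (A : set (g_sigma_algebraType G)).
  exact: sub_sigma_algebra.
by apply: measurable_funM => //; exact: measurable_indic.
Qed.

End measurable_wrt_theory.

(** Since [D] may change sign, its integral is not a measure in the domain; instead the measurable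
    sets where it vanishes are shown to form a Dynkin system. Having [setT] in [G] gives
    complements, countable additivity gives disjoint unions. *)
Lemma integral_eq0_pi_system (d : measure_display) (T : measurableType d)
    (R : realType) (mu : {measure set T -> \bar R}) (D : T -> \bar R)
    (G : set_system T) :
  mu.-integrable setT D -> setI_closed G -> G `<=` measurable -> G setT ->
  (forall A, G A -> (\int[mu]_(t in A) D t = 0)%E) ->
  forall A, <<s G >> A -> (\int[mu]_(t in A) D t = 0)%E.
Proof.
move=> intD GI Gm GT G0 A.
rewrite -setI_closed_g_dynkin_g_sigma_algebra// => GA.
suff : [set E | measurable E /\ (\int[mu]_(t in E) D t = 0)%E] A by case.
move: A GA; apply: smallest_sub => [|E GE]; last first.
  by split; [exact: Gm|exact: G0].
have intDE E : measurable E -> mu.-integrable E D.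
  by move=> mE; exact: integrableS intD.
split=> [|E [mE E0]|F tF mF].
- by split; [exact: Gm|exact: G0].
- split; first exact: measurableC.
  have := G0 _ GT; rewrite -(setUv E) integral_setU ?E0 ?add0e//.
  + exact: measurableC.
  + by rewrite setUv; exact: measurable_int intD.
  + by rewrite disj_set2E setICr.
- have mU : measurable (\bigcup_k F k).
    by apply: bigcupT_measurable => k; case: (mF k).
  split=> //; rewrite integral_bigcup//; last 2 first.
  + by move=> k; case: (mF k).
  + exact: intDE.
  by apply: eseries0 => k _ _; case: (mF k).
Qed.

(** The set where [D] is nonnegative belongs to [G], as does its complement; the integral of the
    absolute value splits over them into two integrals of [D], up to sign, both null. *)
Lemma integral_eq0_ae (d : measure_display) (T : measurableType d)
    (R : realType) (P : {measure set T -> \bar R}) (D : T -> R)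
    (G : set_system T) :
  sigma_algebra setT G -> G `<=` measurable -> measurable_wrt G D ->
  P.-integrable setT (fun t => (D t)%:E) ->
  (forall A, G A -> (\int[P]_(t in A) (D t)%:E = 0)%E) ->
  \forall t \ae P, D t = 0.
Proof.
move=> sG Gm mD intD D0.
have mDE := measurable_int _ intD.
have mabs : measurable_fun setT (fun t => `|(D t)%:E|%E).
  exact: measurableT_comp.
pose A := D @^-1` `[0, +oo[%classic.
have GA : G A by apply: mD; exact: measurable_itv.
have GAC : G (~` A) by exact: sigma_algebra_setC.
have mA := Gm _ GA; have mAC := Gm _ GAC.
suff : (\int[P]_t `|(D t)%:E| = 0)%E.
  move/(ae_eq_integral_abs P measurableT mDE).
  by apply: filterS => t /(_ I) [].
rewrite -(setUv A) integral_setU//; last 2 first.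
- by rewrite setUv.
- by rewrite disj_set2E setICr.
have -> : (\int[P]_(t in A) `|(D t)%:E| = \int[P]_(t in A) (D t)%:E)%E.
  apply: eq_integral => t; rewrite inE /A/= in_itv/= andbT => Dt.
  by rewrite ger0_norm.
have -> : (\int[P]_(t in ~` A) `|(D t)%:E| =
           \int[P]_(t in ~` A) - (D t)%:E)%E.
  apply: eq_integral => t; rewrite inE /A/= in_itv/= andbT => /negP.
  by rewrite -ltNge => Dt; rewrite ltr0_norm.
have intDC : P.-integrable (~` A) (fun t => (D t)%:E).
  exact: integrableS intD.
rewrite integralN; last exact: integrable_add_def intDC.
by rewrite !D0// oppe0 adde0.
Qed.

(** Over [A] in [G] and [C] in [K], the integral on the intersection is that of [D * \1_A] over [C].
    This product is [H]-measurable, hence independent of [C], so the value is [P C] times the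
    integral of [D] over [A], which is 0. The algebra [H] is there because [D] will be an estimation
    error, not measurable for [G]. *)
Lemma integral_eq0_indep_join (d : measure_display) (T : measurableType d)
    (R : realType) (P : probability T R) (D : T -> R) (G H K : set_system T) :
  sigma_algebra setT G -> sigma_algebra setT H -> sigma_algebra setT K ->
  G `<=` H -> H `<=` measurable -> K `<=` measurable ->
  (forall A C, H A -> K C -> P (A `&` C) = (P A * P C)%E) ->
  measurable_wrt H D -> P.-integrable setT (fun t => (D t)%:E) ->
  (forall A, G A -> (\int[P]_(t in A) (D t)%:E = 0)%E) ->
  forall E, <<s G `|` K >> E -> (\int[P]_(t in E) (D t)%:E = 0)%E.
Proof.
move=> sG sH sK GH Hm Km HK mD intD D0 E GKE.
pose J := [set E | exists A C, [/\ G A, K C & E = A `&` C]].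
have GT := sigma_algebraT sG; have KT := sigma_algebraT sK.
apply: (@integral_eq0_pi_system _ _ _ _ _ J) => //.
- move=> _ _ [A [C [GA KC ->]]] [A' [C' [GA' KC' ->]]].
  exists (A `&` A'), (C `&` C'); split; last by rewrite setIACA.
    exact: sigma_algebra_setI.
  exact: sigma_algebra_setI.
- move=> _ [A [C [/GH/Hm mA /Km mC ->]]]; exact: measurableI.
- by exists setT, setT; rewrite setIT.
- move=> _ [A [C [GA KC ->]]].
  have mA := Hm _ (GH _ GA); have mC := Km _ KC.
  have DA : (fun t => (D t * \1_A t)%:E) = (fun t => (D t)%:E) \_ A.
    by rewrite epatch_indic; apply/funext => t; rewrite /= EFinM.
  rewrite setIC integral_mkcondr -DA integral_indep_setI ?DA//.
  + by rewrite -integral_mkcond D0// mule0.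
  + by apply/(integrable_mkcond _ mA); exact: integrableS intD.
  + move=> B mB; apply: HK => //.
    exact: (measurable_wrt_indic sH (GH _ GA) mD).
- apply: (smallest_sub _ _ GKE); first exact: smallest_sigma_algebra.
  move=> F [GF|KF]; apply: sub_sigma_algebra.
    by exists F, setT; rewrite setIT.
  by exists setT, F; rewrite setTI.
Qed.

(** * Information sigma-algebras *)

Lemma vec_measurable_coord (T : Type) (R : realType) (n : nat)
    (G : set_system T) (X : T -> 'cV[R]_n) (i : 'I_n) :
  vec_measurable G X -> measurable_wrt G (fun t => X t i 0).
Proof.
by move=> mX B mB; apply: mX; apply: sub_sigma_algebra; exists i, B.
Qed.

Lemma vec_measurableP (T : pointedType) (R : realType) (n : nat)
    (G : set_system T) (X : T -> 'cV[R]_n) : sigma_algebra setT G ->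
  vec_measurable G X <-> forall i, measurable_wrt G (fun t => X t i 0).
Proof.
move=> sG; split=> [mX i|mX]; first exact: vec_measurable_coord.
by apply: smallest_sub => // _ [i [B mB ->]]; exact: mX.
Qed.

Lemma vec_measurableS (T : Type) (R : realType) (n : nat)
    (G H : set_system T) (X : T -> 'cV[R]_n) :
  G `<=` H -> vec_measurable G X -> vec_measurable H X.
Proof. by move=> GH mX A /mX /GH. Qed.

Lemma vec_measurableD (T : pointedType) (R : realType) (n : nat)
    (G : set_system T) (X Y : T -> 'cV[R]_n) : sigma_algebra setT G ->
  vec_measurable G X -> vec_measurable G Y ->
  vec_measurable G (fun t => X t + Y t).
Proof.
move=> sG; rewrite !vec_measurableP// => mX mY i.
under eq_fun do rewrite mxE.
exact: measurable_wrtD.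
Qed.

Lemma vec_measurable_mulmx (T : pointedType) (R : realType) (m n : nat)
    (G : set_system T) (A : 'M[R]_(m, n)) (X : T -> 'cV[R]_n) :
  sigma_algebra setT G -> vec_measurable G X ->
  vec_measurable G (fun t => A *m X t).
Proof.
move=> sG; rewrite !vec_measurableP// => mX i.
under eq_fun do rewrite mxE.
by apply: measurable_wrt_sum => // j; exact: measurable_wrtZ.
Qed.

Section information.
Context (T : Type) (R : realType) (n m1 m2 : nat).
Variables (x0 x1 : nat -> T -> 'cV[R]_n).
Variables (u0 : nat -> T -> 'cV[R]_m1) (u1 : nat -> T -> 'cV[R]_m2).

Lemma leader_info_algebra k : sigma_algebra setT (leader_info x0 u0 k).
Proof. exact: smallest_sigma_algebra. Qed.

Lemma follower_info_algebra k :
  sigma_algebra setT (follower_info x0 u0 x1 u1 k).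
Proof. exact: smallest_sigma_algebra. Qed.

Lemma leader_info_state j k : (j <= k)%N ->
  vec_measurable (leader_info x0 u0 k) (x0 j).
Proof.
move=> jk; apply: smallest_sub; first exact: leader_info_algebra.
by move=> A XA; apply: sub_sigma_algebra; left; exists j.
Qed.

Lemma leader_info_control j k : (j < k)%N ->
  vec_measurable (leader_info x0 u0 k) (u0 j).
Proof.
move=> jk; apply: smallest_sub; first exact: leader_info_algebra.
by move=> A XA; apply: sub_sigma_algebra; right; exists j.
Qed.

Lemma leader_info_sub k (G : set_system T) : sigma_algebra setT G ->
  (forall j, (j <= k)%N -> vec_measurable G (x0 j)) ->
  (forall j, (j < k)%N -> vec_measurable G (u0 j)) ->
  leader_info x0 u0 k `<=` G.
Proof.
move=> sG mx mu; apply: smallest_sub => // A [] [j jk XA].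
  by apply: (mx j jk); exact: sub_sigma_algebra.
by apply: (mu j jk); exact: sub_sigma_algebra.
Qed.

Lemma leader_info_mono j k : (j <= k)%N ->
  leader_info x0 u0 j `<=` leader_info x0 u0 k.
Proof.
move=> jk; apply: leader_info_sub; first exact: leader_info_algebra.
  by move=> i ij; apply: leader_info_state; exact: leq_trans jk.
by move=> i ij; apply: leader_info_control; exact: leq_trans jk.
Qed.

(** States are known up to the current time but controls only before it, so the new generators are
    [x0 k.+1] and [u0 k]. *)
Lemma leader_info_recS k (G : set_system T) : sigma_algebra setT G ->
  leader_info x0 u0 k `<=` G -> vec_measurable G (u0 k) ->
  vec_measurable G (x0 k.+1) -> leader_info x0 u0 k.+1 `<=` G.
Proof.
move=> sG FG mu mx; apply: leader_info_sub => // j.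
  rewrite leq_eqVlt => /predU1P[-> //|]; rewrite ltnS => jk.
  by apply: vec_measurableS FG _; exact: leader_info_state.
rewrite ltnS leq_eqVlt => /predU1P[-> //|jk].
by apply: vec_measurableS FG _; exact: leader_info_control.
Qed.

Lemma leader_follower_info k :
  leader_info x0 u0 k `<=` follower_info x0 u0 x1 u1 k.
Proof.
apply: leader_info_sub; first exact: follower_info_algebra.
  move=> j jk; apply: smallest_sub; first exact: follower_info_algebra.
  by move=> A XA; apply: sub_sigma_algebra; constructor 1; exists j.
move=> j jk; apply: smallest_sub; first exact: follower_info_algebra.
by move=> A XA; apply: sub_sigma_algebra; constructor 2; exists j.
Qed.

Lemma follower_info_state j k : (j <= k)%N ->
  vec_measurable (follower_info x0 u0 x1 u1 k) (x1 j).
Proof.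
move=> jk; apply: smallest_sub; first exact: follower_info_algebra.
by move=> A XA; apply: sub_sigma_algebra; constructor 3; exists j.
Qed.

Lemma follower_info_control j k : (j < k)%N ->
  vec_measurable (follower_info x0 u0 x1 u1 k) (u1 j).
Proof.
move=> jk; apply: smallest_sub; first exact: follower_info_algebra.
by move=> A XA; apply: sub_sigma_algebra; constructor 4; exists j.
Qed.

Lemma follower_info_sub k (G : set_system T) : sigma_algebra setT G ->
  leader_info x0 u0 k `<=` G ->
  (forall j, (j <= k)%N -> vec_measurable G (x1 j)) ->
  (forall j, (j < k)%N -> vec_measurable G (u1 j)) ->
  follower_info x0 u0 x1 u1 k `<=` G.
Proof.
move=> sG LG mx mu; apply: smallest_sub => // A [] [j jk XA].
- by apply: LG; apply: sub_sigma_algebra; left; exists j.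
- by apply: LG; apply: sub_sigma_algebra; right; exists j.
- by apply: (mx j jk); exact: sub_sigma_algebra.
- by apply: (mu j jk); exact: sub_sigma_algebra.
Qed.

Lemma follower_info_recS k (G : set_system T) : sigma_algebra setT G ->
  follower_info x0 u0 x1 u1 k `<=` G ->
  vec_measurable G (u0 k) -> vec_measurable G (x0 k.+1) ->
  vec_measurable G (u1 k) -> vec_measurable G (x1 k.+1) ->
  follower_info x0 u0 x1 u1 k.+1 `<=` G.
Proof.
move=> sG FG mu0 mx0 mu1 mx1; apply: follower_info_sub => //.
- apply: leader_info_recS => //.
  exact: subset_trans (@leader_follower_info k) FG.
- move=> j; rewrite leq_eqVlt => /predU1P[-> //|]; rewrite ltnS => jk.
  by apply: vec_measurableS FG _; exact: follower_info_state.
- move=> j; rewrite ltnS leq_eqVlt => /predU1P[-> //|jk].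
  by apply: vec_measurableS FG _; exact: follower_info_control.
Qed.

End information.

(** * Information carried by the dynamics and by the noises *)

Section dynamics.
Context (T : pointedType) (R : realType) (N n m1 m2 : nat).
Variables (A00 A10 A11 : 'M[R]_n) (B00 B10 : 'M[R]_(n, m1)).
Variables (B11 : 'M[R]_(n, m2)) (x0 x1 w0 w1 : nat -> T -> 'cV[R]_n).
Variables (u0 : nat -> T -> 'cV[R]_m1) (u1 : nat -> T -> 'cV[R]_m2).
Hypothesis dyn0 : forall k t, (k <= N)%N ->
  x0 k.+1 t = A00 *m x0 k t + B00 *m u0 k t + w0 k t.
Hypothesis dyn1 : forall k t, (k <= N)%N ->
  x1 k.+1 t = A11 *m x1 k t + B11 *m u1 k t + w1 k t
              + A10 *m x0 k t + B10 *m u0 k t.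
Hypothesis adm0 : forall k, (k <= N)%N ->
  vec_measurable (leader_info x0 u0 k) (u0 k).
Hypothesis adm1 : forall k, (k <= N)%N ->
  vec_measurable (follower_info x0 u0 x1 u1 k) (u1 k).

(** Admissibility makes [u0 k] known from the information at [k], so the only novelty in [x0 k.+1]
    is [w0 k]. The algebra [G] is left free: it will be the one generated by the noises, and also
    the join of F0(k) with the events of [w0 k]. *)
Lemma leader_info_step k (G : set_system T) : (k <= N)%N ->
  sigma_algebra setT G -> leader_info x0 u0 k `<=` G ->
  vec_measurable G (w0 k) -> leader_info x0 u0 k.+1 `<=` G.
Proof.
move=> kN sG FG mw.
have mu : vec_measurable G (u0 k) by exact: vec_measurableS FG (adm0 kN).
have mx : vec_measurable G (x0 k).
  by apply: vec_measurableS FG _; exact: leader_info_state.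
apply: leader_info_recS => //.
rewrite (_ : x0 k.+1 = (fun t => A00 *m x0 k t + B00 *m u0 k t + w0 k t)).
  by do 2 apply: vec_measurableD => //; exact: vec_measurable_mulmx.
by apply/funext => t; exact: dyn0.
Qed.

Lemma follower_info_step k (G : set_system T) : (k <= N)%N ->
  sigma_algebra setT G -> follower_info x0 u0 x1 u1 k `<=` G ->
  vec_measurable G (w0 k) -> vec_measurable G (w1 k) ->
  follower_info x0 u0 x1 u1 k.+1 `<=` G.
Proof.
move=> kN sG FG mw0 mw1.
have LG := subset_trans (@leader_follower_info _ _ _ _ _ x0 x1 u0 u1 k) FG.
have mu0 : vec_measurable G (u0 k) by exact: vec_measurableS LG (adm0 kN).
have mx0 : vec_measurable G (x0 k).
  by apply: vec_measurableS LG _; exact: leader_info_state.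
have mu1 : vec_measurable G (u1 k) by exact: vec_measurableS FG (adm1 kN).
have mx1 : vec_measurable G (x1 k).
  by apply: vec_measurableS FG _; exact: follower_info_state.
have LG1 := leader_info_step kN sG LG mw0.
apply: follower_info_recS => //.
  by apply: vec_measurableS LG1 _; exact: leader_info_state.
rewrite (_ : x1 k.+1 = (fun t => A11 *m x1 k t + B11 *m u1 k t + w1 k t
              + A10 *m x0 k t + B10 *m u0 k t)).
  by do 4 (apply: vec_measurableD => //; try exact: vec_measurable_mulmx).
by apply/funext => t; exact: dyn1.
Qed.

(** On the right, the state is frozen at its initial value and the noise takes the place of the
    control: the strict bound on control times yields exactly the sigma-algebra of [x0 0] and the
    noises [w0 j] with [j < k]. *)
Lemma leader_info_noise k : (k <= N)%N ->
  leader_info x0 u0 k `<=` leader_info (fun=> x0 0%N) w0 k.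
Proof.
elim: k => [_|k IHk kN].
  apply: leader_info_sub => //; first exact: leader_info_algebra.
  move=> j; rewrite leqn0 => /eqP ->.
  exact: (@leader_info_state _ _ _ _ (fun=> x0 0%N) _ 0).
apply: leader_info_step; first exact: ltnW.
- exact: leader_info_algebra.
- apply: subset_trans (IHk (ltnW kN)) _.
  exact: leader_info_mono.
- exact: leader_info_control.
Qed.

Lemma follower_info_noise k : (k <= N)%N ->
  follower_info x0 u0 x1 u1 k `<=`
  follower_info (fun=> x0 0%N) w0 (fun=> x1 0%N) w1 k.
Proof.
elim: k => [_|k IHk kN].
  apply: follower_info_sub => //; first exact: follower_info_algebra.
    apply: subset_trans (leader_info_noise (leq0n N)) _.
    exact: leader_follower_info.
  move=> j; rewrite leqn0 => /eqP ->.
  exact: (@follower_info_state _ _ _ _ _ _ (fun=> x1 0%N) _ _ 0).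
apply: follower_info_step; first exact: ltnW.
- exact: follower_info_algebra.
- apply: subset_trans (IHk (ltnW kN)) _.
  apply: follower_info_sub; first exact: follower_info_algebra.
  + apply: subset_trans (@leader_follower_info _ _ _ _ _ _ _ _ _ k.+1).
    exact: leader_info_mono.
  + move=> j jk.
    exact: (@follower_info_state _ _ _ _ _ _ (fun=> x1 0%N) _ _ 0).
  + by move=> j jk; apply: follower_info_control; exact: ltnW.
- apply: vec_measurableS (@leader_follower_info _ _ _ _ _ _ _ _ _ k.+1) _.
  exact: leader_info_control.
- exact: follower_info_control.
Qed.

End dynamics.

(** * Independence of the current noise from the past *)

Section noise_independence.
Context (d : measure_display) (T : measurableType d) (R : realType).
Variables (P : probability T R) (n k : nat).
Variables x0 x1 w0 w1 : nat -> T -> 'cV[R]_n.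
Hypothesis mx0 : vec_measurable measurable (x0 0%N).
Hypothesis mx1 : vec_measurable measurable (x1 0%N).
Hypothesis mw0 : forall j, (j <= k)%N -> vec_measurable measurable (w0 j).
Hypothesis mw1 : forall j, (j <= k)%N -> vec_measurable measurable (w1 j).
Hypothesis indep : mutually_independent P (primitive_vectors x0 x1 w0 w1 k).

Let mprimitive i :
  vec_measurable measurable (primitive_vectors x0 x1 w0 w1 k i).
Proof.
by case: i => [[]|[[] j]] //=; [apply: mw1|apply: mw0]; rewrite -ltnS.
Qed.

Let indep_others (i0 : bool + bool * 'I_k.+1) (H : set_system T) (A C : set T) :
  H `<=` [set E | exists2 i, i \in [set~ i0]%SET &
    coord_events (primitive_vectors x0 x1 w0 w1 k i) E] ->
  <<s H >> A -> sigma_vec (primitive_vectors x0 x1 w0 w1 k i0) C ->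
  P (A `&` C) = (P A * P C)%E.
Proof.
move=> HJ sA sC.
apply: (mutually_independent_group mprimitive indep
  (J := [set~ i0]%SET) _ _ sC).
  by rewrite !inE eqxx.
apply: (smallest_sub _ _ sA); first exact: smallest_sigma_algebra.
exact: subset_trans HJ (@sub_sigma_algebra _ _ _).
Qed.

Lemma follower_noise_indep (A C : set T) :
  follower_info (fun=> x0 0%N) w0 (fun=> x1 0%N) w1 k A ->
  sigma_vec (w0 k) C -> P (A `&` C) = (P A * P C)%E.
Proof.
apply: (indep_others (i0 := inr (false, ord_max))) => E.
case=> [[j _ XE]|[j jk XE]|[j _ XE]|[j jk XE]].
- by exists (inl false); rewrite ?inE.
- have jk1 : (j < k.+1)%N by exact: ltnW.
  (* The bound [j < k] is strict, so this index differs from that of [w0 k]. *)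
  exists (inr (false, Ordinal jk1)) => //; rewrite !inE; apply/eqP => -[jE].
  by rewrite jE ltnn in jk.
- by exists (inl true); rewrite ?inE.
- have jk1 : (j < k.+1)%N by exact: ltnW.
  by exists (inr (true, Ordinal jk1)) => //; rewrite !inE.
Qed.

(** The information is taken at [k.+1], thus including [w0 k], because the dynamics are conditioned
    on F0(k+1); no follower noise is among its generators. *)
Lemma leader_noise_indep (A C : set T) :
  leader_info (fun=> x0 0%N) w0 k.+1 A ->
  sigma_vec (w1 k) C -> P (A `&` C) = (P A * P C)%E.
Proof.
apply: (indep_others (i0 := inr (true, ord_max))) => E.
case=> [[j _ XE]|[j jk XE]]; first by exists (inl false); rewrite ?inE.
by exists (inr (false, Ordinal jk)); rewrite ?inE.
Qed.

Lemma leader_initial_indep (A C : set T) :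
  leader_info (fun=> x0 0%N) w0 0 A ->
  sigma_vec (x1 0%N) C -> P (A `&` C) = (P A * P C)%E.
Proof.
apply: (indep_others (i0 := inl true)) => E.
by case=> [[j _ XE]|[j //]]; exists (inl false); rewrite ?inE.
Qed.

Lemma follower_noise_measurable :
  follower_info (fun=> x0 0%N) w0 (fun=> x1 0%N) w1 k `<=` measurable.
Proof.
have sm : sigma_algebra setT (measurable : set_system T).
  exact: sigma_algebra_measurable.
apply: follower_info_sub => //.
  by apply: leader_info_sub => // j jk; apply: mw0; exact: ltnW.
by move=> j jk; apply: mw1; exact: ltnW.
Qed.

End noise_independence.

(** This says that 0 is a version of the conditional expectation of [D] given [G]. Identities
    between conditional expectations become closure of this property under linear combinations. *)
Definition cond_exp_eq0 (d : measure_display) (T : measurableType d)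
    (R : realType) (P : probability T R) (G : set_system T) (D : T -> R) :=
  P.-integrable setT (fun t => (D t)%:E) /\
  forall A, G A -> (\int[P]_(t in A) (D t)%:E = 0)%E.

Section cond_exp_eq0_theory.
Context (d : measure_display) (T : measurableType d) (R : realType).
Variables (P : probability T R) (G : set_system T).
Hypotheses (sG : sigma_algebra setT G) (Gm : G `<=` measurable).
Implicit Types D : T -> R.

Lemma cond_exp_eq0D D1 D2 : cond_exp_eq0 P G D1 -> cond_exp_eq0 P G D2 ->
  cond_exp_eq0 P G (fun t => D1 t + D2 t).
Proof.
move=> [i1 z1] [i2 z2]; split.
  by apply: eq_integrable (integrableD measurableT i1 i2).
move=> A GA; have mA := Gm GA.
under eq_integral do rewrite EFinD.
rewrite integralD//; [|exact: integrableS i1|exact: integrableS i2].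
by rewrite z1// z2// adde0.
Qed.

Lemma cond_exp_eq0Z (a : R) D : cond_exp_eq0 P G D ->
  cond_exp_eq0 P G (fun t => a * D t).
Proof.
move=> [iD zD]; split.
  by apply: eq_integrable (integrableZl measurableT a iD).
move=> A GA; have mA := Gm GA.
under eq_integral do rewrite EFinM.
by rewrite integralZl//; [rewrite zD// mule0|exact: integrableS iD].
Qed.

Lemma cond_exp_eq0_sum (I : finType) (D : I -> T -> R) :
  (forall i, cond_exp_eq0 P G (D i)) ->
  cond_exp_eq0 P G (fun t => \sum_i D i t).
Proof.
move=> zD; elim: (index_enum I) => [|i s IHs].
  split=> [|A GA].
    under [fun t => _]funext do rewrite big_nil.
    exact: finite_measure_integrable_cst.
  by apply: integral0_eq => t _; rewrite big_nil.
under [fun t => _]funext do rewrite big_cons.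
exact: cond_exp_eq0D.
Qed.

(** Testing on the whole space shows that the integral of [X] is that of [Y], hence finite, and a
    measurable real function with a finite integral is integrable. *)
Lemma is_cond_exp_integrable (n : nat) (X Y : T -> 'cV[R]_n) (i : 'I_n) :
  is_cond_exp P G X Y -> vec_measurable measurable X ->
  P.-integrable setT (fun t => (X t i 0)%:E).
Proof.
move=> [mY /(_ i)[intY XY]] mX.
have mXi : measurable_fun setT (fun t => X t i 0).
  by move=> _ B mB; rewrite setTI; exact: (vec_measurable_coord i mX).
apply/integrableP; split; first exact/measurable_EFinP.
rewrite integral_fin_num_abs// -XY; last exact: sigma_algebraT.
exact: integrable_fin_num intY.
Qed.

Lemma is_cond_exp_eq0 (n : nat) (X Y : T -> 'cV[R]_n) (i : 'I_n) :
  is_cond_exp P G X Y -> vec_measurable measurable X ->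
  cond_exp_eq0 P G (fun t => X t i 0 - Y t i 0).
Proof.
move=> XY mX; have intX := is_cond_exp_integrable i XY mX.
have [_ /(_ i)[intY YE]] := XY.
split; first by apply: eq_integrable (integrableB measurableT intX intY).
move=> A GA; have mA := Gm GA.
under eq_integral do rewrite EFinB.
have intXA := integrableS measurableT mA (@subsetT _ _) intX.
rewrite integralB//; last exact: integrableS intY.
by rewrite YE// subee//; exact: integrable_fin_num intXA.
Qed.

(** By independence the integral of [X] over [A] is [P A] times its mean, as for the constant. The
    mean is general to cover both the initial state and the centered noise. *)
Lemma cond_exp_eq0_centered (n : nat) (X : T -> 'cV[R]_n) (mu : 'cV[R]_n)
    (S : 'M[R]_n) (i : 'I_n) : gaussian P X mu S ->
  (forall A C, G A -> sigma_vec X C -> P (A `&` C) = (P A * P C)%E) ->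
  cond_exp_eq0 P G (fun t => X t i 0 - mu i 0).
Proof.
move=> gX GX; have [intX EX] := gaussian_moment i gX.
have intc : P.-integrable setT (cst (mu i 0)%:E).
  exact: finite_measure_integrable_cst.
split; first by apply: eq_integrable (integrableB measurableT intX intc).
move=> A GA; have mA := Gm GA.
under eq_integral do rewrite EFinB.
rewrite integralB//; [|exact: integrableS intX|exact: integrableS intc].
rewrite integral_indep_setI// ?EX ?integral_cst//.
  by rewrite muleC subee// fin_numM// fin_num_measure.
move=> B mB; rewrite setIC muleC GX//.
exact: (@vec_measurable_coord _ _ _ (sigma_vec X)).
Qed.

Lemma cond_exp_eq0_ae D : measurable_wrt G D -> cond_exp_eq0 P G D ->
  \forall t \ae P, D t = 0.
Proof. by move=> mD [iD zD]; exact: integral_eq0_ae zD. Qed.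

End cond_exp_eq0_theory.

(** * The recursion for the leader's estimate *)

Theorem theorem1 (d : measure_display) (T : measurableType d) (R : realType)
  (P : probability T R) (N n m1 m2 : nat)
  (A00 A10 A11 : 'M[R]_n) (B00 B10 : 'M[R]_(n, m1)) (B11 : 'M[R]_(n, m2))
  (x0 x1 w0 w1 : nat -> T -> 'cV[R]_n)
  (u0 : nat -> T -> 'cV[R]_m1) (u1 : nat -> T -> 'cV[R]_m2)
  (xbar0 xbar1 : 'cV[R]_n) (Sx0 Sx1 Sw0 Sw1 : 'M[R]_n)
  (Q PN1 : 'M[R]_(n + n)) (Rw : 'M[R]_(m1 + m2))
  (xhat1 : nat -> T -> 'cV[R]_n) (uhat1 : nat -> T -> 'cV[R]_m2)
  (dyn0 : forall k t, (k <= N)%N ->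
     x0 k.+1 t = A00 *m x0 k t + B00 *m u0 k t + w0 k t)
  (dyn1 : forall k t, (k <= N)%N ->
     x1 k.+1 t = A11 *m x1 k t + B11 *m u1 k t + w1 k t
                 + A10 *m x0 k t + B10 *m u0 k t)
  (gauss_x0 : gaussian P (x0 0%N) xbar0 Sx0)
  (gauss_x1 : gaussian P (x1 0%N) xbar1 Sx1)
  (gauss_w0 : forall k, (k <= N)%N -> gaussian P (w0 k) 0 Sw0)
  (gauss_w1 : forall k, (k <= N)%N -> gaussian P (w1 k) 0 Sw1)
  (indep : forall k, (k <= N)%N ->
     mutually_independent P (primitive_vectors x0 x1 w0 w1 k))
  (adm0 : forall k, (k <= N)%N -> vec_measurable (leader_info x0 u0 k) (u0 k))
  (adm1 : forall k, (k <= N)%N ->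
     vec_measurable (follower_info x0 u0 x1 u1 k) (u1 k))
  (energy0 :
     (\sum_(k < N.+1) 'E_P[fun t => ((u0 k t)^T *m u0 k t)%R 0%R 0%R] < +oo)%E)
  (energy1 :
     (\sum_(k < N.+1) 'E_P[fun t => ((u1 k t)^T *m u1 k t)%R 0%R 0%R] < +oo)%E)
  (Q_psd : psdmx Q) (Rw_pd : pdmx Rw) (PN1_psd : psdmx PN1)
  (xhat1E : forall k, (k <= N)%N ->
     is_cond_exp P (leader_info x0 u0 k) (x1 k) (xhat1 k))
  (uhat1E : forall k, (k <= N)%N ->
     is_cond_exp P (leader_info x0 u0 k) (u1 k) (uhat1 k)) :
  (\forall t \ae P, xhat1 0%N t = xbar1) /\
  (forall k, (1 <= k <= N)%N ->
     \forall t \ae P,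
       xhat1 k t = A11 *m xhat1 k.-1 t + B11 *m uhat1 k.-1 t
                   + A10 *m x0 k.-1 t + B10 *m u0 k.-1 t).
Proof.
have sL k := leader_info_algebra x0 u0 k.
have mx0 : vec_measurable measurable (x0 0%N) by case: gauss_x0.
have mx1 : vec_measurable measurable (x1 0%N) by case: gauss_x1.
have mw0 k : (k <= N)%N -> vec_measurable measurable (w0 k).
  by move=> /gauss_w0[].
have mw1 k : (k <= N)%N -> vec_measurable measurable (w1 k).
  by move=> /gauss_w1[].
have leN j k : (j <= k)%N -> (k <= N)%N -> (j <= N)%N by exact: leq_trans.
pose H k := follower_info (fun=> x0 0%N) w0 (fun=> x1 0%N) w1 k.
have sH k : sigma_algebra setT (H k) by exact: follower_info_algebra.
have Hm k : (k <= N)%N -> H k `<=` measurable.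
  by move=> kN; apply: follower_noise_measurable => // j jk;
    [apply: mw0|apply: mw1]; exact: leN kN.
have FH k : (k <= N)%N -> follower_info x0 u0 x1 u1 k `<=` H k.
  exact: (follower_info_noise dyn0 dyn1 adm0 adm1).
have LH k : (k <= N)%N -> leader_info x0 u0 k `<=` H k.
  move=> kN; apply: subset_trans (FH k kN).
  exact: leader_follower_info.
have Lm k : (k <= N)%N -> leader_info x0 u0 k `<=` measurable.
  by move=> kN; exact: subset_trans (LH k kN) (Hm k kN).
have mX1 k : (k <= N)%N -> vec_measurable (H k) (x1 k).
  by move=> kN; apply: vec_measurableS (FH k kN) _; exact: follower_info_state.
have mU1 k : (k <= N)%N -> vec_measurable (H k) (u1 k).
  by move=> kN; apply: vec_measurableS (FH k kN) _; exact: adm1.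
(* There are finitely many coordinates, so their exceptional null sets can be merged. *)
have ae_vec (X Y : T -> 'cV[R]_n) :
    (forall i, \forall t \ae P, X t i 0 - Y t i 0 = 0) ->
    \forall t \ae P, X t = Y t.
  move=> XY.
  have : \forall t \ae P, forall i, X t i 0 - Y t i 0 = 0.
    exact: filter_forall.
  apply: filterS => t XYt.
  by apply/colP => i; apply/eqP; rewrite -subr_eq0; apply/eqP.
split.
  apply: ae_vec => i; apply: (cond_exp_eq0_ae (sL 0%N) (Lm _ (leq0n N))).
    apply: measurable_wrtB => //.
      by apply: vec_measurable_coord; case: (xhat1E _ (leq0n N)).
    apply/measurable_wrtP => //; exact: measurable_cst.
  (* Inserting [x1 0] splits the difference into an estimation error and the deviation of [x1 0]
     from its mean, the latter independent of F0(0). *)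
  rewrite (_ : (fun t => _) = fun t => -1 * (x1 0%N t i 0 - xhat1 0%N t i 0) +
      (x1 0%N t i 0 - xbar1 i 0)); last by apply/funext => t; ring.
  apply: cond_exp_eq0D => //; first exact: Lm.
    apply: cond_exp_eq0Z => //; first exact: Lm.
    by apply: is_cond_exp_eq0 => //; [exact: Lm|exact: xhat1E].
  apply: (cond_exp_eq0_centered (Lm _ (leq0n N)) i gauss_x1) => A C LA XC.
  apply: (leader_initial_indep mx0 mx1 _ _ (indep _ (leq0n N)) _ XC).
  - by move=> j; rewrite leqn0 => /eqP ->; exact: mw0.
  - by move=> j; rewrite leqn0 => /eqP ->; exact: mw1.
  - exact: (leader_info_noise dyn0 adm0 (leq0n N)) LA.
(* From here [k] is the earlier time: the estimate at [k.+1], with [k.+1 <= N], is compared with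
   data at [k]. *)
case=> // k /= kN; have kN' := ltnW kN.
have LS : leader_info x0 u0 k `<=` leader_info x0 u0 k.+1.
  exact: leader_info_mono.
have mw0k j : (j <= k)%N -> vec_measurable measurable (w0 j).
  by move=> jk; apply: mw0; exact: leN kN'.
have mw1k j : (j <= k)%N -> vec_measurable measurable (w1 j).
  by move=> jk; apply: mw1; exact: leN kN'.
have join_sub : leader_info x0 u0 k.+1 `<=`
    <<s leader_info x0 u0 k `|` sigma_vec (w0 k) >>.
  apply: (leader_info_step dyn0 adm0 kN'); first exact: smallest_sigma_algebra.
    by move=> A LA; apply: sub_sigma_algebra; left.
  by move=> A WA; apply: sub_sigma_algebra; right.
(* The error made with F0(k) stays null against the richer F0(k+1). The dimension [m] is free so
   that states and controls of the follower are both covered. *)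
have lift m (X Xhat : nat -> T -> 'cV[R]_m) (j : 'I_m) :
    vec_measurable (H k) (X k) ->
    is_cond_exp P (leader_info x0 u0 k) (X k) (Xhat k) ->
    cond_exp_eq0 P (leader_info x0 u0 k.+1) (fun t => X k t j 0 - Xhat k t j 0).
  move=> mX XE.
  have mXm := vec_measurableS (Hm k kN') mX.
  have [iD zD] := is_cond_exp_eq0 (sL k) (Lm k kN') j XE mXm.
  split=> // A /join_sub; apply: (integral_eq0_indep_join (H := H k)) => //.
  - exact: sigma_vec_algebra.
  - exact: LH.
  - exact: Hm.
  - exact: mw0.
  - move=> B C; exact: (follower_noise_indep mx0 mx1 mw0k mw1k (indep _ kN')).
  - apply: measurable_wrtB => //.
      exact: vec_measurable_coord.
    apply: vec_measurable_coord.
    by apply: vec_measurableS (LH k kN') _; case: XE.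
apply: ae_vec => i; apply: (cond_exp_eq0_ae (sL k.+1) (Lm _ kN)).
  apply: measurable_wrtB => //; apply: vec_measurable_coord.
    by case: (xhat1E _ kN).
  have mL m (X : T -> 'cV[R]_m) : vec_measurable (leader_info x0 u0 k) X ->
      vec_measurable (leader_info x0 u0 k.+1) X by exact: vec_measurableS.
  do 3 (apply: vec_measurableD => //; last by apply: vec_measurable_mulmx => //;
    apply: mL; first [exact: leader_info_state | exact: adm0
                     | by case: (uhat1E _ kN')]).
  by apply: vec_measurable_mulmx => //; apply: mL; case: (xhat1E _ kN').
(* Inserting [x1 k.+1] and expanding it by the dynamics cancels the [A10] and [B10] terms. What
   remains is errors plus the noise, whose zero mean is kept explicit to match the centered form. *)
rewrite (_ : (fun t => _) = fun t =>
    -1 * (x1 k.+1 t i 0 - xhat1 k.+1 t i 0) +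
    (\sum_j A11 i j * (x1 k t j 0 - xhat1 k t j 0) +
     \sum_j B11 i j * (u1 k t j 0 - uhat1 k t j 0) +
     (w1 k t i 0 - (0 : 'cV[R]_n) i 0))); last first.
  apply/funext => t; rewrite dyn1//.
  under eq_bigr do rewrite mulrBr.
  under [X in _ + (_ + X + _)]eq_bigr do rewrite mulrBr.
  by rewrite !sumrB !mxE; ring.
have LmS := Lm _ kN.
apply: cond_exp_eq0D => //.
  apply: cond_exp_eq0Z => //; apply: is_cond_exp_eq0 => //.
    exact: xhat1E.
  exact: vec_measurableS (Hm _ kN) (mX1 _ kN).
apply: cond_exp_eq0D => //; first apply: cond_exp_eq0D => //.
- apply: cond_exp_eq0_sum => // j; apply: cond_exp_eq0Z => //.
  by apply: lift; [exact: mX1 | exact: xhat1E].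
- apply: cond_exp_eq0_sum => // j; apply: cond_exp_eq0Z => //.
  by apply: lift; [exact: mU1 | exact: uhat1E].
- apply: (cond_exp_eq0_centered LmS i (gauss_w1 _ kN')) => A C LA WC.
  apply: (leader_noise_indep mx0 mx1 mw0k mw1k (indep _ kN') _ WC).
  exact: (leader_info_noise dyn0 adm0 kN) LA.
Qed.
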